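(* There exists a $5$-uniform hypergraph $\mathcal{H}$ that has no polychromatic $3$-coloring, but all the $3$-heavy restricted subhypergraphs of $\mathcal{H}$ are $2$-colorable. Consequently, for the hereditary family $\mathcal{F}$ consisting of all restricted subhypergraphs of $\mathcal{H}$, we have $m_3(\mathcal{F})=6$ and $m_2(\mathcal{F})=3$.
   Context: A hypergraph $\mathcal{H}=(V,E)$ consists of a finite vertex set $V$ and a collection $E$ of subsets of $V$ (edges). It is $m$-uniform if all edges have size exactly $m$, and $m$-heavy if all edges have size at least $m$. $\mathcal{H}'=(V',E')$ is a subhypergraph of $\mathcal{H}=(V,E)$ if $V'\subset V$ and $E'\subset E$. For $X\subset V$, the trace (restriction) of $\mathcal{H}$ on $X$ is $\mathcal{H}[X]=(X,\{e\cap X: e\in E\})$. A restricted subhypergraph of $\mathcal{H}$ is a subhypergraph of some trace of $\mathcal{H}$. A family of hypergraphs is hereditary if it is closed under taking subhypergraphs and traces. A $k$-coloring of the vertices of a hypergraph is polychromatic if every edge contains a vertex of each of the $k$ colors; a hypergraph is $2$-colorable if it has a polychromatic $2$-coloring. For a family $\mathcal{F}$ of hypergraphs, $m_k(\mathcal{F})$ is the least $m$ such that every $m$-heavy hypergraph in $\mathcal{F}$ has a polychromatic $k$-coloring, and $m_k(\mathcal{F})=\infty$ if no such $m$ exists. *)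

(* Defs.v *)
From mathcomp Require Import all_boot finmap.
From mathcomp Require Import boolp.

Set Implicit Arguments.
Unset Strict Implicit.
Unset Printing Implicit Defensive.

Local Open Scope fset_scope.

(* The finite vertex set lives in an arbitrary, possibly infinite, ambient type
   [T], so that families of hypergraphs on [T] may be infinite. *)
Record hypergraph (T : choiceType) := Hypergraph {
  vertices : {fset T};
  edges : {fset {fset T}};
  edges_sub : forall e, e \in edges -> e `<=` vertices }.

Section Hypergraphs.
Variable T : choiceType.
Implicit Types (G H : hypergraph T) (X : {fset T}).

Definition uniform (m : nat) H : Prop :=
  forall e, e \in edges H -> #|` e| = m.

Definition heavy (m : nat) H : Prop :=
  forall e, e \in edges H -> m <= #|` e|.

Definition subhypergraph G H : Prop :=
  vertices G `<=` vertices H /\ edges G `<=` edges H.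

Lemma trace_edges_sub H X e :
  e \in [fset f `&` X | f in edges H] -> e `<=` X.
Proof. by case/imfsetP => f _ ->; exact: fsubsetIr. Qed.

Definition trace H X : hypergraph T := Hypergraph (@trace_edges_sub H X).

Definition restricted_subhypergraph H G : Prop :=
  exists2 X, X `<=` vertices H & subhypergraph G (trace H X).

Definition hereditary (F : hypergraph T -> Prop) : Prop :=
  (forall H G, F H -> subhypergraph G H -> F G) /\
  (forall H X, F H -> X `<=` vertices H -> F (trace H X)).

(* A colouring is defined on the vertices only: [vertices H] is coerced to the
   type of its elements. *)
Definition polychromatic (k : nat) H (c : vertices H -> 'I_k) : Prop :=
  forall e, e \in edges H ->
  forall i : 'I_k, exists2 v : vertices H, val v \in e & c v = i.

Definition polychromatic_colorable (k : nat) H : Prop :=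
  exists c : vertices H -> 'I_k, polychromatic c.

Definition two_colorable H : Prop := polychromatic_colorable 2 H.

Definition heavy_colorable (F : hypergraph T -> Prop) (k m : nat) : Prop :=
  forall G, F G -> heavy m G -> polychromatic_colorable k G.

(* [None] stands for infinity. *)
Definition m_ (k : nat) (F : hypergraph T -> Prop) : option nat :=
  if pselect (exists m, `[< heavy_colorable F k m >]) is left ex_m
  then Some (ex_minn ex_m) else None.

End Hypergraphs.

(* Main.v *)
(** A family of 5-element edges on 8 points is the family of complements of a
    family of triples.  A 3-coloring of 8 points has a class with at most two
    points, so it is never polychromatic as soon as the triples cover all pairs:
    the complement of a triple containing that class misses its color.

    The affine plane of order 3 minus one point has 8 lines of size 3, here
    [{i, i+1, i+3}] modulo 8, which cover all pairs but [{i, i+4}]; four more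
    triples cover these.  A set of 6, 7 or 8 points (or of at most 4) always has
    a balanced split that is bad for no trace of size at least 3.  A set [X] of 5
    points contains a line (caps of the plane have at most 4 points), and the
    extra triples are such that [X] has a pair covered only by triples inside
    [X]: this pair against the rest of [X] is a good 2-coloring. *)

Require Import Defs.
From mathcomp Require Import all_boot finmap.
From mathcomp Require Import boolp.

Set Implicit Arguments.
Unset Strict Implicit.
Unset Printing Implicit Defensive.

Local Open Scope fset_scope.

Section General.
Variable T : choiceType.
Implicit Types (G H : hypergraph T) (F : hypergraph T -> Prop).

Lemma m_eq k F m :
  heavy_colorable F k m -> (forall n, n < m -> ~ heavy_colorable F k n) ->
  m_ k F = Some m.
Proof.
move=> Fm ltFm; rewrite /m_; case: pselect => [ex_m|[]]; last first.
  by exists m; apply/asboolP.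
case: ex_minnP => n /asboolP Fn minn; congr Some.
apply/eqP; rewrite eqn_leq minn ?andTb; last exact/asboolP.
by rewrite leqNgt; apply/negP => /ltFm.
Qed.

Lemma restricted_subhypergraph_refl H : restricted_subhypergraph H H.
Proof.
exists (vertices H) => //; split=> //=.
apply/fsubsetP => e eH; apply/imfsetP; exists e => //=.
by apply/esym/fsetIidPl/edges_sub.
Qed.

Lemma hereditary_restricted_subhypergraph H :
  hereditary (restricted_subhypergraph H).
Proof.
split=> [G G' [X XH [GX GE]] [G'G G'E]|G Y [X XH [/= GX GE]] YG].
  by exists X => //; split; [exact: fsubset_trans GX|exact: fsubset_trans GE].
have YX := fsubset_trans YG GX.
exists Y; first exact: fsubset_trans XH.
split=> //=; apply/fsubsetP => e /imfsetP[/= f fG ->].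
have /imfsetP[/= g gH ->] := fsubsetP GE f fG.
apply/imfsetP; exists g => //=.
by rewrite -fsetIA; congr (_ `&` _); apply/fsetIidPr.
Qed.

(** Traces of edges have at most [m] elements, so an [m.+1]-heavy [G] has no edge and any coloring
    is vacuously polychromatic. *)
Lemma uniform_heavy_colorable m k H : uniform m H ->
  heavy_colorable (restricted_subhypergraph H) k.+1 m.+1.
Proof.
move=> Hm G [X _ [_ GE]] Gm; exists (fun=> ord0) => e eG.
have /imfsetP[/= f fH ef] := fsubsetP GE e eG.
by have := fsubset_leq_card (fsubsetIl f X); rewrite -ef (Hm f fH) leqNgt Gm.
Qed.

End General.

(** Colorings and vertex subsets (as bit masks) become lists, so that quantifying over them can be
    evaluated. *)
Fixpoint words (A : eqType) (s : seq A) (n : nat) : seq (seq A) :=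
  if n is n'.+1 then [seq a :: w | a <- s, w <- words s n'] else [:: [::]].

Lemma mkseq_words (A : eqType) (s : seq A) (f : nat -> A) n :
  (forall i, f i \in s) -> mkseq f n \in words s n.
Proof.
move=> fs; rewrite /mkseq; elim: n 0 => //= n IHn m.
apply: allpairs_f; [exact: fs|exact: IHn].
Qed.

Section Explicit.
Variables (n : nat) (E : seq (seq nat)).
Hypothesis ltE : all (all (gtn n)) E.

Lemma edge_ltn s i : s \in E -> i \in s -> i < n.
Proof. by move=> sE; apply: (allP (allP ltE s sE)). Qed.

Lemma explicit_edges_sub (e : {fset nat}) :
  e \in [fset [fset i in s] | s : seq nat in E] -> e `<=` [fset i in iota 0 n].
Proof.
case/imfsetP => s sE ->; apply/fsubsetP => i; rewrite !inE mem_iota.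
exact: edge_ltn.
Qed.

Definition explicit_hypergraph : hypergraph nat :=
  Hypergraph explicit_edges_sub.

Lemma explicit_edge s : s \in E -> [fset i in s] \in edges explicit_hypergraph.
Proof. by move=> sE; apply/imfsetP; exists s. Qed.

Lemma explicit_uniform m :
  all uniq E -> all (fun s => size s == m) E -> uniform m explicit_hypergraph.
Proof.
move=> Eu Em e /imfsetP[s sE ->].
by rewrite card_fseq undup_id ?(allP Eu) //; apply/eqP/(allP Em).
Qed.

Lemma explicit_not_colorable k :
  all (fun w => has (fun s => has (fun a => a \notin map (nth 0 w) s)
                                  (iota 0 k)) E) (words (iota 0 k) n) ->
  0 < k -> ~ polychromatic_colorable k explicit_hypergraph.
Proof.
move=> /allP noc k_gt0 [c cP].
(* The default 0 is a legal color because [0 < k]. *)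
pose f i := if insub i is Some v then val (c v) else 0.
have /noc/hasP[s sE /hasP[a]] : mkseq f n \in words (iota 0 k) n.
  by apply: mkseq_words => i; rewrite mem_iota /f; case: insub => //= v.
rewrite mem_iota add0n /= => ltak /mapP[].
have [v] := cP _ (explicit_edge sE) (Ordinal ltak).
rewrite inE => vs /(congr1 val)/= cv; exists (val v) => //.
by rewrite nth_mkseq ?(edge_ltn sE vs) // /f (valK v).
Qed.

(** One coloring [w] per set [X] suffices: it handles all edges of the trace of size at least [m],
    and the edges of any [m]-heavy [G] are among these. *)
Lemma explicit_heavy_colorable k m :
  all uniq E ->
  all (fun x => has (fun w => all (fun s => (m <= count (nth false x) s) ==>
        all (fun a => has (fun i => nth false x i && (nth 0 w i == a)) s)
            (iota 0 k.+1)) E) (words (iota 0 k.+1) n))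
      (words [:: false; true] n) ->
  heavy_colorable (restricted_subhypergraph explicit_hypergraph) k.+1 m.
Proof.
move=> Eu /allP col G [X _ [_ GE]] Gm.
have /col/hasP[w _ /allP wP] : mkseq (mem X) n \in words [:: false; true] n.
  by apply: mkseq_words => i; case: (mem X i).
exists (fun v => inord (nth 0 w (val v))) => e eG a.
have /imfsetP[/= f /imfsetP[/= s sE ->] eE] := fsubsetP GE e eG.
have xE i : i \in s -> nth false (mkseq (mem X) n) i = (i \in X).
  by move=> si; rewrite nth_mkseq // (edge_ltn sE si).
(* As a duplicate-free filtered list, [e] has the [count] of the boolean check as its
   cardinality. *)
have es : e = [fset i in [seq i <- s | i \in X]].
  by apply/fsetP => i; rewrite eE !inE /= mem_filter andbC.
have := Gm e eG; rewrite {1}es card_fseq undup_id ?filter_uniq ?(allP Eu) //.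
rewrite size_filter -(eq_in_count xE) => /(implyP (wP s sE))/allP/(_ (val a)).
rewrite mem_iota => /(_ (ltn_ord a))/hasP[i si /andP[]].
rewrite xE // => iX /eqP wi.
have ie : i \in e by rewrite es !inE /= mem_filter iX.
exists [` fsubsetP (edges_sub eG) i ie]; first exact: ie.
by rewrite /= wi inord_val.
Qed.

End Explicit.

Definition blocks : seq (seq nat) :=
  [seq [:: i; i.+1 %% 8; i.+3 %% 8] | i <- iota 0 8] ++
  [seq [:: i; i.+1; i.+4] | i <- iota 0 4].

Definition quintuples : seq (seq nat) :=
  [seq [seq i <- iota 0 8 | i \notin b] | b <- blocks].

Definition H8 : hypergraph nat :=
  @explicit_hypergraph 8 quintuples isT.

(** An odd cycle, the witness for the lower bound on [m_ 2]. *)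
Definition triangle : hypergraph nat :=
  @explicit_hypergraph 3 [:: [:: 0; 1]; [:: 0; 2]; [:: 1; 2]] isT.

Lemma H8_uniform : uniform 5 H8.
Proof. exact: explicit_uniform. Qed.

Lemma H8_not_3colorable : ~ polychromatic_colorable 3 H8.
Proof. by apply: explicit_not_colorable; [vm_compute|]. Qed.

Lemma H8_heavy_2colorable :
  heavy_colorable (restricted_subhypergraph H8) 2 3.
Proof. by apply: explicit_heavy_colorable; vm_compute. Qed.

Lemma triangle_not_2colorable : ~ polychromatic_colorable 2 triangle.
Proof. exact: explicit_not_colorable. Qed.

Lemma triangle_uniform : uniform 2 triangle.
Proof. exact: explicit_uniform. Qed.

(** The blocks [{2,3,5}], [{1,6,7}] and [{0,5,6}] each meet [{0,1,2}] in one point, so their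
    complements cut out the three pairs. *)
Lemma triangle_restricted_H8 : restricted_subhypergraph H8 triangle.
Proof.
exists [fset i in iota 0 3].
  by apply/fsubsetP => i; rewrite !inE; case/or4P => // /eqP->.
split=> //=; apply/fsubsetP => _ /imfsetP[/= s sE ->].
have /allP/(_ s sE)/hasP[t tE /eqP ts] :
  all (fun s => has (fun t => [seq i <- t | i \in iota 0 3] == s) quintuples)
      [:: [:: 0; 1]; [:: 0; 2]; [:: 1; 2]] by [].
apply/imfsetP; exists [fset i in t]; first by apply/imfsetP; exists t.
by apply/fsetP => i; rewrite -ts !inE /= mem_filter !inE orbF andbC.
Qed.

Theorem theorem3 :
  exists (T : choiceType) (H : hypergraph T),
    [/\ uniform 5 H,
        ~ polychromatic_colorable 3 H
      & forall G : hypergraph T,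
          restricted_subhypergraph H G -> heavy 3 G -> two_colorable G] /\
    [/\ hereditary (restricted_subhypergraph H),
        m_ 3 (restricted_subhypergraph H) = Some 6
      & m_ 2 (restricted_subhypergraph H) = Some 3].
Proof.
exists nat, H8; split; split.
- exact: H8_uniform.
- exact: H8_not_3colorable.
- exact: H8_heavy_2colorable.
- exact: hereditary_restricted_subhypergraph.
(* For [n < 6], the 5-uniform [H8] is itself an [n]-heavy counterexample. *)
- apply: m_eq => [|n n_lt6 /(_ H8)]; first exact/uniform_heavy_colorable/H8_uniform.
  move=> /(_ (restricted_subhypergraph_refl _)) H8n; apply: H8_not_3colorable.
  by apply: H8n => e /H8_uniform ->.
- apply: m_eq => [|n n_lt3 /(_ triangle triangle_restricted_H8) Tn].
    exact: H8_heavy_2colorable.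
  by apply: triangle_not_2colorable; apply: Tn => e /triangle_uniform ->.
Qed.
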